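(* Let $\varepsilon_1$ and $\varepsilon_2$ be the total privacy budget that each data holder uses in responding to the analyst's queries during the structure learning phase (the algorithm ''Noisy Majority Voting'') and during the parameter learning phase (the algorithm ''Distributed BN Parameter Learning'', in which the needed frequency distributions are retrieved from the data holders), respectively. Then the overall algorithm satisfies $(\varepsilon_1+\varepsilon_2)$-differential privacy for any dataset $D_j$, $j\in\{1,\dots,M\}$.
   Context: Data: $\mathcal{A}=\{X_1,\dots,X_N\}$ is a set of attributes with finite domains; $M$ data holders possess disjoint datasets $D_1,\dots,D_M$ of records (tuples of values of the $N$ attributes). Differential privacy (bounded version): two datasets are adjacent if one is obtained from the other by changing the value of a single record. A randomized algorithm $\mathbf{Alg}$ is $\varepsilon$-differentially private if for all sets $O$ of outputs and all adjacent $D,D'$, $\mathbb{P}[\mathbf{Alg}(D)\in O]\le e^{\varepsilon}\,\mathbb{P}[\mathbf{Alg}(D')\in O]$. ''For any dataset $D_j$'' means that this holds with $D_j$ as the input that is changed to an adjacent dataset, the other holders' datasets being fixed; everything the analyst sees or outputs counts as output. Noisy Majority Voting (input: $D_1,\dots,D_M$, degree $k$): start with an arbitrary attribute $X$, put $(X,\emptyset)$ in the structure $\mathcal{G}$ and $X$ in $V$. Repeat $N-1$ times: each holder $j$ returns one pair $(X,\mathbf{Pa}(X))$ with $X\in\mathcal{A}\setminus V$, $\mathbf{Pa}(X)\subseteq V$, $|\mathbf{Pa}(X)|\le k$ (its vote); the analyst adds the most-voted pair (ties broken arbitrarily) to $\mathcal{G}$ and its first component to $V$. Each vote is drawn by the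 exponential mechanism with privacy budget $\frac{\varepsilon_1}{N-1}$: a pair is returned with probability proportional to $\exp\!\left(\frac{\varepsilon_1\,\hat I(X;\mathbf{Pa}(X))}{2(N-1)\,\Delta\hat I}\right)$, where $\hat I$ is the empirical mutual information in $D_j$ and $\Delta\hat I$ is its sensitivity, i.e. the maximum change of $\hat I$ over adjacent datasets (maximized also over the candidate pairs). Distributed BN Parameter Learning: given $\mathcal{G}$, for each $i\in\{1,\dots,N\}$ the analyst retrieves from each holder $j$ a noisy joint frequency distribution (vector of counts) $\tilde{\mathbf{c}}^{(j)}_{X_i,\mathbf{Pa}(X_i)}$, produced by the Laplace mechanism with privacy budget $\frac{\varepsilon_2}{N}$ (i.i.d. $\mathrm{Laplace}(0,2N/\varepsilon_2)$ noise, with density $\frac{1}{2s}e^{-|x|/s}$ for scale $s=2N/\varepsilon_2$, added to every count; the $\ell_1$-sensitivity of the vector of counts is $2$). It computes $\tilde{\mathbf{p}}_{X_i,\mathbf{Pa}(X_i)}=\frac1n\sum_j\tilde{\mathbf{c}}^{(j)}_{X_i,\mathbf{Pa}(X_i)}$, where $n$ is the total number of records, and from it the conditional distributions $\tilde{\mathbf{p}}_{X_i\mid\mathbf{Pa}(X_i)}$, which it outputs. All random choices are independent. The overall algorithm runs the first procedure and then the second one on the structure $\mathcal{G}$ obtained. *)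

(* Defs.v *)
From HB Require Import structures.
From mathcomp Require Import all_boot all_order all_algebra.
From mathcomp Require Import all_classical all_reals all_analysis.
From mathcomp Require Import measurable_realfun.

Set Implicit Arguments.
Unset Strict Implicit.
Unset Printing Implicit Defensive.
Import Order.TTheory GRing.Theory Num.Theory.
Import numFieldNormedType.Exports.
Local Open Scope classical_set_scope.
Local Open Scope ring_scope.

Definition laplace_pdf {R : realType} (s x : R) : R :=
  (2 * s)^-1 * expR (- `|x| / s).

(* The Dirac mass is a junk value, so that this is a probability for all [s]. *)
Definition laplace_prob {R : realType} (s : R) (A : set R) : \bar R :=
  if 0 < s then (\int[lebesgue_measure]_(x in A) (laplace_pdf s x)%:E)%E
  else \d_(0 : R) A.

Section laplace_prob.
Context {R : realType} (s : R).
Local Notation mu := (@lebesgue_measure R).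

Lemma laplace_pdf_ge0 x : 0 < s -> 0 <= laplace_pdf s x.
Proof.
by move=> s0; rewrite mulr_ge0 ?expR_ge0// invr_ge0 mulr_ge0// ltW.
Qed.

Lemma continuous_laplace_pdf : continuous (laplace_pdf s).
Proof.
move=> x; rewrite /laplace_pdf; apply: cvgM; first exact: cvg_cst.
apply: continuous_comp; last exact: continuous_expR.
apply: cvgM; last exact: cvg_cst.
by apply: cvgN; exact: norm_continuous.
Qed.

Lemma measurable_laplace_pdf : measurable_fun [set: R] (laplace_pdf s).
Proof. exact: continuous_measurable_fun continuous_laplace_pdf. Qed.

Lemma integral_laplace_pdf : 0 < s -> (\int[mu]_x (laplace_pdf s x)%:E = 1)%E.
Proof.
move=> s0; rewrite ge0_symfun_integralT; last 3 first.
- by move=> x; exact: laplace_pdf_ge0.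
- exact: continuous_laplace_pdf.
- by move=> x; rewrite /laplace_pdf/= normrN.
have sV0 : 0 < s^-1 by rewrite invr_gt0.
have mD : measurable [set x : R | 0 <= x].
  by rewrite -set_itvcy; exact: measurable_itv.
transitivity (2 * \int[mu]_(x in [set x : R | (0 <= x)%R])
    (2^-1%:E * (exponential_pdf s^-1 x)%:E))%E.
  congr (_ * _)%E; apply: eq_integral => x; rewrite inE/= => x0.
  rewrite exponential_pdfE// /laplace_pdf ger0_norm// -EFinM.
  congr EFin; rewrite invfM -mulrA; congr (_ * (_ * expR _)).
  by rewrite !mulNr mulrC.
rewrite ge0_integralZl//; last 2 first.
- by apply/measurable_funTS/measurable_EFinP; exact: measurable_exponential_pdf.
- by move=> x _; rewrite lee_fin exponential_pdf_ge0// ltW.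
rewrite muleA -EFinM divff// mul1e -[RHS](integral_exponential_pdf sV0).
rewrite integral_mkcond; apply: eq_integral => x _.
rewrite /patch; case: ifPn => //; rewrite notin_setE/= => /negP.
by rewrite -ltNge => x0; rewrite lt0_exponential_pdf.
Qed.

Let laplace0 : laplace_prob s set0 = 0%E.
Proof.
by rewrite /laplace_prob; case: ifPn; rewrite ?integral_set0// measure0.
Qed.

Let laplace_ge0 A : (0 <= laplace_prob s A)%E.
Proof.
rewrite /laplace_prob; case: ifPn => // s0; apply: integral_ge0 => x _.
by rewrite lee_fin laplace_pdf_ge0.
Qed.

Let laplace_sigma_additive : semi_sigma_additive (laplace_prob s).
Proof.
move=> F mF tF mUF; rewrite /laplace_prob; case: ifPn => s0; last first.
  exact: measure_semi_sigma_additive.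
apply: cvg_toP.
  apply: ereal_nondecreasing_is_cvgn => m n mn.
  apply: lee_sum_nneg_natr => // k _ _; apply: integral_ge0 => /= x Fkx.
  by rewrite lee_fin laplace_pdf_ge0.
rewrite ge0_integral_bigcup//=.
- by apply/measurable_funTS/measurable_EFinP; exact: measurable_laplace_pdf.
- by move=> x _; rewrite lee_fin laplace_pdf_ge0.
Qed.

HB.instance Definition _ := isMeasure.Build _ _ _
  (laplace_prob s) laplace0 laplace_ge0 laplace_sigma_additive.

Let laplace_setT : laplace_prob s [set: R] = 1%E.
Proof.
rewrite /laplace_prob; case: ifPn => s0; first exact: integral_laplace_pdf.
by rewrite diracT.
Qed.

HB.instance Definition _ :=
  @Measure_isProbability.Build _ _ R (laplace_prob s) laplace_setT.

End laplace_prob.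

Section product_probability.
Local Open Scope ereal_scope.
Context {d1 d2} {T1 : measurableType d1} {T2 : measurableType d2}
  {R : realType} (P : probability T1 R) (Q : probability T2 R).

Let prod := P \x Q.

HB.instance Definition _ := Measure.on prod.

Let prod_setT : prod setT = 1.
Proof.
transitivity (P setT * Q setT); last by rewrite !probability_setT mule1.
by rewrite -setXTT; exact: product_measure1E.
Qed.

HB.instance Definition _ := @Measure_isProbability.Build _ _ R prod prod_setT.

Definition product_probability : probability (T1 * T2)%type R := prod.

End product_probability.

Section iid.
Context {R : realType} (P : probability R R).

Definition consT n (p : R * n.-tuple R) : n.+1.-tuple R :=
  [tuple of p.1 :: p.2].

Let measurable_consT n : measurable_fun setT (@consT n).
Proof. exact: measurable_cons. Qed.

HB.instance Definition _ n := isMeasurableFun.Build _ _ _ _ _ (@measurable_consT n).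

Fixpoint iid n : probability (n.-tuple R) R :=
  match n with
  | 0 => \d_([tuple] : 0.-tuple R)
  | n'.+1 => distribution (product_probability P (iid n')) (@consT n')
  end.

End iid.

(* Real vectors indexed by a finite type, with the product sigma-algebra. *)
Definition vec (R : realType) (I : finType) := #|I|.-tuple R.

Definition vcoord (R : realType) (I : finType) (v : vec R I) (i : I) : R :=
  tnth v (enum_rank i).

Definition mkvec (R : realType) (I : finType) (f : I -> R) : vec R I :=
  [tuple f (enum_val t) | t < #|I|].

Lemma measurable_vcoord (R : realType) (I : finType) (i : I) :
  measurable_fun [set: vec R I] (fun v => vcoord v i).
Proof. exact: measurable_tnth. Qed.

Lemma measurable_mkvec d (T : measurableType d) (R : realType) (I : finType)
    (f : T -> I -> R) :
  (forall i, measurable_fun setT (f ^~ i)) ->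
  measurable_fun setT (fun x => mkvec (f x)).
Proof.
move=> mf; apply/measurable_fun_tnthP => t.
rewrite (_ : _ \o _ = f ^~ (enum_val t)); first exact: mf.
by apply/funext => x /=; rewrite tnth_mktuple.
Qed.

Lemma measurable_invr (R : realType) :
  measurable_fun [set: R] (fun x : R => x^-1).
Proof.
have -> : (fun x : R => x^-1) = (fun x => if x == 0 then 0 else x^-1).
  by apply/funext => x; case: eqVneq => // ->; rewrite invr0.
have m0 : measurable_fun [set: R] (fun x : R => x == 0).
  exact: measurable_fun_eqr.
apply: measurable_fun_if => //; rewrite setTI.
have -> : (fun x : R => x == 0) @^-1` [set false] = ~` [set 0].
  by apply/seteqP; split=> x /=; [move/eqP | move=> /eqP/negbTE].
apply: open_continuous_measurable_fun.
  by rewrite openC; exact: closed_eq.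
by move=> x; rewrite inE/= => /eqP x0; exact: inv_continuous.
Qed.

Section datasets.
Variables (N : nat) (dom : 'I_N -> finType).

Definition record := {dffun forall i : 'I_N, dom i}.

Definition dataset (n : nat) := n.-tuple record.

Definition adjacent n (D D' : dataset n) : bool :=
  #|[pred l : 'I_n | tnth D l != tnth D' l]| == 1%N.

(* A joint value of the attributes in [S] is represented by the partial
   assignment which is defined exactly on [S]. *)
Definition passign := {dffun forall i : 'I_N, option (dom i)}.

Definition passign_dom (a : passign) : {set 'I_N} :=
  [set i | a i != None]%SET.

Definition prestrict (S : {set 'I_N}) (a : passign) : passign :=
  [ffun i => if i \in S then a i else None].

Definition value_on (S : {set 'I_N}) (r : record) : passign :=
  prestrict S [ffun i => Some (r i)].

Definition freq n (D : dataset n) (S : {set 'I_N}) (a : passign) : nat :=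
  count (fun r => value_on S r == a) D.

Variable R : realType.

Definition emp n (D : dataset n) (S : {set 'I_N}) (a : passign) : R :=
  (freq D S a)%:R / n%:R.

(* The base of the logarithm is immaterial: the exponential mechanism divides by
   the sensitivity. *)
Definition mutual_info n (D : dataset n) (i : 'I_N) (Pa : {set 'I_N}) : R :=
  \sum_(a : passign | passign_dom a == i |: Pa)
    emp D (i |: Pa) a *
    ln (emp D (i |: Pa) a /
        (emp D [set i]%SET (prestrict [set i]%SET a) * emp D Pa (prestrict Pa a))).

Definition mi_sensitivity (n k : nat) : R :=
  \big[Num.max/0]_(DD : dataset n * dataset n | adjacent DD.1 DD.2)
  \big[Num.max/0]_(c : 'I_N * {set 'I_N} | (c.1 \notin c.2) && (#|c.2| <= k)%N)
    `|mutual_info DD.1 c.1 c.2 - mutual_info DD.2 c.1 c.2|.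

End datasets.

(* The probability of an outcome [t] of the exponential mechanism with budget
   [eps] on the set of candidates [C]; if [sens = 0] then the exponent is [0]. *)
Definition exp_mechanism (R : realType) (T : finType) (C : {set T})
    (eps sens : R) (score : T -> R) (t : T) : R :=
  if t \in C then
    expR (eps * score t / (2 * sens)) /
    \sum_(u in C) expR (eps * score u / (2 * sens))
  else 0.

Definition differentially_private (R : realType) (N : nat)
    (dom : 'I_N -> finType) (n : nat) d (O : measurableType d) (eps : R)
    (alg : dataset dom n -> probability O R) : Prop :=
  forall D D' : dataset dom n, adjacent D D' ->
  forall A : set O, measurable A ->
    (alg D A <= (expR eps)%:E * alg D' A)%E.

Section structures.
Variables (N M : nat).

Definition vote := ('I_N * {set 'I_N})%type.

Definition bn_structure := {set vote}.

Definition profile := {ffun 'I_M -> vote}.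

Definition attrs (G : bn_structure) : {set 'I_N} := [set c.1 | c in G]%SET.

(* In a structure built by the algorithm, [i] is the first component of exactly
   one pair, so that the union has a single member. *)
Definition parents (G : bn_structure) (i : 'I_N) : {set 'I_N} :=
  (\bigcup_(c in G | c.1 == i) c.2)%SET.

Definition candidates (k : nat) (G : bn_structure) : {set vote} :=
  [set c : vote | [&& c.1 \notin attrs G, c.2 \subset attrs G & #|c.2| <= k]%N]%SET.

Definition most_voted (v : profile) (c : vote) : Prop :=
  forall c' : vote, (#|[pred j | v j == c']| <= #|[pred j | v j == c]|)%N.

(* What the analyst sees and computes during structure learning: the votes,
   round by round, and the structure. All sets of transcripts are measurable. *)
Definition transcript := (seq profile * bn_structure)%type.

HB.instance Definition _ := Choice.on transcript.
HB.instance Definition _ :=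
  isPointed.Build transcript ([::], finset.set0).
HB.instance Definition _ := @isMeasurable.Build default_measure_display
  transcript discrete_measurable discrete_measurable0
  discrete_measurableC discrete_measurableU.

End structures.

Section algorithm.
Variables (R : realType) (N M : nat) (dom : 'I_N -> finType).
Variables (nrec : 'I_M -> nat) (k : nat) (eps1 eps2 : R) (X0 : 'I_N).
(* [tiebreak h v] is the pair that the analyst adds to the structure after the
   votes [v], where [h] are the votes of the previous rounds. *)
Variable tiebreak : seq (profile N M) -> profile N M -> vote N.
Variable D : forall j : 'I_M, dataset dom (nrec j).

Local Notation cell := (passign dom).
Local Notation count_index := ('I_N * 'I_M * cell)%type.
Local Notation table_index := ('I_N * cell)%type.

Definition nrecords : nat := (\sum_(j < M) nrec j)%N.

Definition vote_prob (G : bn_structure N) (j : 'I_M) (c : vote N) : R :=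
  exp_mechanism (candidates k G) (eps1 / N.-1%:R)
    (mi_sensitivity dom R (nrec j) k)
    (fun c => mutual_info R (D j) c.1 c.2) c.

Definition fam (G : bn_structure N) (i : 'I_N) : {set 'I_N} :=
  i |: parents G i.

(* The counts released for attribute [i] by holder [j] are indexed by the joint
   values of the family of [i]; the remaining coordinates are [0]. *)
Definition noisy_count (G : bn_structure N) (z : vec R count_index)
    (ija : count_index) : R :=
  let: (i, j, a) := ija in
  if passign_dom a == fam G i
  then (freq (D j) (fam G i) a)%:R + vcoord z (i, j, a) else 0.

Definition noisy_joint G z (ia : table_index) : R :=
  nrecords%:R^-1 * \sum_(j < M) noisy_count G z (ia.1, j, ia.2).

(* The denominator is the noisy frequency of the parents' values; it is nonzero
   almost surely. *)
Definition noisy_cond G z (ia : table_index) : R :=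
  noisy_joint G z ia /
  \sum_(b : cell | (passign_dom b == fam G ia.1) &&
      (prestrict (parents G ia.1) b == prestrict (parents G ia.1) ia.2))
    noisy_joint G z (ia.1, b).

Definition output : Type :=
  (transcript N M *
   (vec R count_index *
    (vec R table_index * vec R table_index)))%type.

Definition release (h : seq (profile N M)) (G : bn_structure N)
    (z : vec R count_index) : output :=
  ((h, G), (mkvec (noisy_count G z),
            (mkvec (noisy_joint G z), mkvec (noisy_cond G z)))).

Definition learn_parameters (h : seq (profile N M)) (G : bn_structure N)
    (A : set output) : \bar R :=
  iid (laplace_prob (2 * N%:R / eps2)) #|{: count_index}|
    (release h G @^-1` A).

(* [r] rounds of voting are left, [h] are the votes so far. *)
Fixpoint run (r : nat) (h : seq (profile N M)) (G : bn_structure N)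
    (A : set output) : \bar R :=
  if r is r'.+1 then
    (\sum_(v : profile N M) (\prod_(j < M) vote_prob G j (v j))%:E *
       run r' (rcons h v) (tiebreak h v |: G)%SET A)%E
  else learn_parameters h G A.

Definition overall : set output -> \bar R :=
  run N.-1 [::] [set (X0, finset.set0)]%SET.

Lemma measurable_release h G : measurable_fun setT (release h G).
Proof.
have mc i : measurable_fun setT (noisy_count G ^~ i).
  case: i => [[i j] a] /=; rewrite /noisy_count; case: (passign_dom a == _) => //.
  by apply: measurable_funD => //; exact: measurable_vcoord.
have mj i : measurable_fun setT (noisy_joint G ^~ i).
  by apply: measurable_funM => //; apply: measurable_sum.
apply: measurable_fun_pair => //; apply: measurable_fun_pair.
  exact: (measurable_mkvec (f := noisy_count G)).
apply: measurable_fun_pair.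
  exact: (measurable_mkvec (f := noisy_joint G)).
apply: (measurable_mkvec (f := noisy_cond G)) => i.
apply: measurable_funM => //.
apply: (measurableT_comp (@measurable_invr R)).
rewrite [X in measurable_fun _ X](_ : _ = fun x => \sum_(b : cell)
    if (passign_dom b == fam G i.1) &&
       (prestrict (parents G i.1) b == prestrict (parents G i.1) i.2)
    then noisy_joint G x (i.1, b) else 0); last first.
  by apply/funext => x; rewrite big_mkcond.
by apply: measurable_sum => b; case: (_ && _).
Qed.

Lemma vote_prob_ge0 G j c : 0 <= vote_prob G j c.
Proof.
rewrite /vote_prob /exp_mechanism; case: ifPn => // _.
by rewrite mulr_ge0 ?expR_ge0// invr_ge0 sumr_ge0// => u _; exact: expR_ge0.
Qed.

Lemma run_ge0 r h G A : (0 <= run r h G A)%E.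
Proof.
elim: r h G => [|r IH] h G /=; first exact: measure_ge0.
apply: sume_ge0 => v _; rewrite mule_ge0// lee_fin prodr_ge0// => j _.
exact: vote_prob_ge0.
Qed.

Lemma run_set0 r h G : run r h G set0 = 0%E.
Proof.
elim: r h G => [|r IH] h G /=.
  by rewrite /learn_parameters preimage_set0 measure0.
by rewrite big1// => v _; rewrite IH mule0.
Qed.

Lemma run_sigma_additive r h G : semi_sigma_additive (run r h G).
Proof.
elim: r h G => [|r IH] h G /= F mF tF mUF.
  rewrite /learn_parameters preimage_bigcup.
  apply: measure_semi_sigma_additive.
  - by move=> i; rewrite -[X in measurable X]setTI; exact: measurable_release.
  - apply/trivIsetP => i j _ _ ij; rewrite -preimage_setI.
    by move/trivIsetP : tF => ->//; rewrite preimage_set0.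
  - by rewrite -preimage_bigcup -[X in measurable X]setTI; exact: measurable_release.
have w0 v : (0 <= (\prod_(j < M) vote_prob G j (v j))%:E)%E.
  by rewrite lee_fin prodr_ge0// => j _; exact: vote_prob_ge0.
rewrite [X in X @ _ --> _](_ : _ = fun n => (\sum_(v : profile N M)
    (\prod_(j < M) vote_prob G j (v j))%:E *
    \sum_(0 <= i < n) run r (rcons h v) (tiebreak h v |: G)%SET (F i))%E).
  apply: cvg_nnesum => [v _|v _].
    apply: nearW => n; rewrite mule_ge0// sume_ge0// => i _; exact: run_ge0.
  by apply: cvgeZl => //; exact: IH.
apply/funext => n; rewrite exchange_big/=; apply: eq_bigr => v _.
by rewrite ge0_sume_distrr// => i _; exact: run_ge0.
Qed.

Lemma card_attrs (G : bn_structure N) : (#|attrs G| <= #|G|)%N.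
Proof. exact: leq_imset_card. Qed.

Lemma sum_vote_prob (G : bn_structure N) j : (#|G| < N)%N -> \sum_c vote_prob G j c = 1.
Proof.
move=> GN.
have [i iG] : exists i, i \notin attrs G.
  apply/existsP; rewrite -negb_forall; apply/negP => /forallP allG.
  have := leq_ltn_trans (card_attrs G) GN.
  have -> : attrs G = finset.setT.
    by apply/setP => x; rewrite finset.in_setT; exact: allG.
  by rewrite cardsT card_ord ltnn.
have C0 : (i, finset.set0) \in candidates k G.
  by rewrite inE/= iG/= finset.sub0set cards0.
rewrite /vote_prob /exp_mechanism -big_mkcond/= -mulr_suml divff// gt_eqF//.
rewrite (bigD1 _ C0)/= ltr_pwDl ?expR_gt0// sumr_ge0//.
Qed.

Lemma run_setT r h (G : bn_structure N) : (r + #|G| <= N)%N -> run r h G setT = 1%E.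
Proof.
elim: r h G => [|r IH] h G /= rG.
  by rewrite /learn_parameters preimage_setT probability_setT.
rewrite (eq_bigr (fun v : profile N M =>
    (\prod_(j < M) vote_prob G j (v j))%:E)); last first.
  move=> v _; rewrite IH ?mule1//; apply: leq_trans rG.
  by rewrite addSnnS leq_add2l cardsU1; case: (_ \notin _).
rewrite sumEFin; congr EFin.
rewrite -(bigA_distr_bigA (fun j c => vote_prob G j c)) big1// => j _.
by rewrite sum_vote_prob//; apply: leq_trans rG; rewrite addSn ltnS leq_addl.
Qed.

Let overall0 : overall set0 = 0%E. Proof. exact: run_set0. Qed.

Let overall_ge0 A : (0 <= overall A)%E. Proof. exact: run_ge0. Qed.

Let overall_sigma_additive : semi_sigma_additive overall.
Proof. exact: run_sigma_additive. Qed.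

HB.instance Definition _ := isMeasure.Build _ _ _
  overall overall0 overall_ge0 overall_sigma_additive.

Let overall_setT : overall setT = 1%E.
Proof.
by apply: run_setT; rewrite cards1 addn1 prednK//; case: N X0 => // -[].
Qed.

HB.instance Definition _ :=
  @Measure_isProbability.Build _ _ R overall overall_setT.

End algorithm.

(* Main.v *)
Require Import Defs.
From HB Require Import structures.
From mathcomp Require Import all_boot all_order all_algebra.
From mathcomp Require Import all_classical all_reals all_analysis.
From mathcomp Require Import measurable_realfun.

Set Implicit Arguments.
Unset Strict Implicit.
Unset Printing Implicit Defensive.
Import Order.TTheory GRing.Theory Num.Theory.
Local Open Scope classical_set_scope.
Local Open Scope ring_scope.

(** The two runs differ only in the data of holder [j].  In each round, the votes
    of [j] have comparable laws by the usual exponential mechanism argument, the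
    two factors [expR (eps / 2)] coming from the weight and from the normalising
    sum; the votes of the other holders have the same law, so that a round costs a
    factor [expR (eps1 / (N - 1))], whatever the structure reached so far.  The
    release of the parameters is a function of the noisy counts, so that changing
    the data amounts to translating the noise.  Translating a Laplace variable of
    scale [s] by [c] costs a factor [expR (`|c| / s)], these factors multiply over
    the independent coordinates, and the translations add up to at most [2] for
    each of the [N] attributes. *)

(** * Translations of the noise *)

Lemma lebesgue_measure_translate (R : realType) (c : R) (A : set R) :
  measurable A ->
  pushforward (@lebesgue_measure R)
    (fun x : R => (x + c)%R : measurableTypeR R) A =
  lebesgue_measure A.
Proof.
move=> mA; apply/esym/lebesgue_measure_unique => //=.
  exact: measurable_funD.
move=> _ _ [[a b] _ <-]; rewrite /pushforward.
have -> : (fun x : R => x + c) @^-1` `]a, b]%classic = `](a - c), (b - c)]%classic.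
  by apply/seteqP; split=> x /=; rewrite !in_itv/= ltrBlDr lerBrDr.
rewrite !lebesgue_measure_itv/= !lte_fin ltrD2r -!EFinB.
by rewrite opprD addrACA subrr addr0.
Qed.

(** A change of variable moves the translation from the set to the density. The two densities are
    then compared pointwise, by the triangle inequality in the exponent. *)
Lemma laplace_prob_translate (R : realType) (s c : R) (A : set R) :
  0 < s -> measurable A ->
  (laplace_prob s ((fun x => (x + c)%R) @^-1` A) <=
   (expR (`|c| / s))%:E * laplace_prob s A)%E.
Proof.
move=> s0 mA; rewrite /laplace_prob s0.
have mc : measurable_fun setT (fun x : R => x + c) by exact: measurable_funD.
have mp := measurable_laplace_pdf s.
have mpc : measurable_fun [set: R] (fun y => laplace_pdf s (y - c)).
  by apply: (measurableT_comp mp); exact: measurable_funD.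
have p0 x : 0 <= laplace_pdf s x by exact: laplace_pdf_ge0.
rewrite (_ : (\int[_]_(x in _) _)%E =
    (\int[lebesgue_measure]_(y in A) (laplace_pdf s (y - c))%:E)%E); last first.
  transitivity (\int[pushforward lebesgue_measure
      (fun x : R => (x + c)%R : measurableTypeR R)]_(y in A)
      (laplace_pdf s (y - c))%:E)%E.
    rewrite ge0_integral_pushforward//=.
    - by apply: eq_integral => x _ /=; rewrite addrK.
    - exact/measurable_funTS/measurable_EFinP.
    - by move=> y _; rewrite lee_fin.
  apply: eq_measure_integral => B mB _; exact: lebesgue_measure_translate.
rewrite -ge0_integralZl_EFin ?expR_ge0//; last 2 first.
- by move=> x _; rewrite lee_fin.
- exact/measurable_funTS/measurable_EFinP.
apply: ge0_le_integral => //=.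
- by move=> x _; rewrite lee_fin.
- exact/measurable_funTS/measurable_EFinP.
- apply/measurable_funTS/measurable_EFinP.
  by apply: measurable_funM.
move=> x _; rewrite -EFinM lee_fin /laplace_pdf mulrCA ler_wpM2l//.
  by rewrite invr_ge0 mulr_ge0// ltW.
rewrite -expRD ler_expR -mulrDl ler_pM2r ?invr_gt0//.
by rewrite lerNl opprB lerB_dist.
Qed.

Section product.
Local Open Scope ereal_scope.
Context d1 d2 (T1 : measurableType d1) (T2 : measurableType d2) (R : realType).
Variables (P : probability T1 R) (Q : probability T2 R).

(** By sections: over a fixed [x], the section of the preimage is the [g]-preimage of the section of
    [C] at [f x], which costs [L]. Integrating over [x] costs [K], since the image of [P] under [f]
    is dominated by [K] times [P]. *)
Lemma product_probability_preimage_le (f : T1 -> T1) (g : T2 -> T2) (K L : R) :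
  (0 <= K)%R -> (0 <= L)%R ->
  measurable_fun setT f -> measurable_fun setT g ->
  (forall A, measurable A -> P (f @^-1` A) <= K%:E * P A) ->
  (forall B, measurable B -> Q (g @^-1` B) <= L%:E * Q B) ->
  forall C, measurable C ->
    product_probability P Q ((fun z => (f z.1, g z.2)) @^-1` C) <=
    (K * L)%:E * product_probability P Q C.
Proof.
move=> K0 L0 mf mg Pf Qg C mC.
have mxC : measurable_fun setT (Q \o xsection C).
  exact: measurable_fun_xsection.
rewrite /product_probability/= /product_measure1.
apply: (@le_trans _ _ (\int[P]_x (L%:E * ((Q \o xsection C) \o f) x))).
  apply: ge0_le_integral => //=.
  - apply: measurable_fun_xsection; rewrite -[X in measurable X]setTI.
    apply: (measurable_fun_pair _ _) => //.
    + exact: (measurableT_comp mf).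
    + exact: (measurableT_comp mg).
  - by apply: measurable_funeM; exact: (measurableT_comp mxC).
  move=> x _; apply: le_trans (Qg _ (measurable_xsection _ mC)).
  by rewrite (_ : xsection _ x = g @^-1` xsection C (f x)).
rewrite ge0_integralZl_EFin//; last exact: (measurableT_comp mxC).
rewrite mulrC EFinM -muleA; apply: lee_wpmul2l; first by rewrite lee_fin.
have <- := ge0_integral_pushforward mf P measurableT mxC
  (fun y _ => measure_ge0 Q _).
(* As a nonnegative number, [K] can scale the measure [P] instead of the integral. *)
have -> : K = (NngNum K0)%:num by [].
rewrite -ge0_integral_mscale//.
by apply: ge0_le_measure_integral => // A mA; exact: Pf.
Qed.

End product.

Lemma iid_translate (R : realType) (P : probability R R) (l : R -> R) :
  (forall (c : R) (A : set R), measurable A ->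
    (P ((fun x => (x + c)%R) @^-1` A) <= (expR (l c))%:E * P A)%E) ->
  forall n (c : 'I_n -> R) (A : set (n.-tuple R)), measurable A ->
    (iid P n ((fun z => [tuple (tnth z i + c i)%R | i < n]) @^-1` A) <=
     (expR (\sum_i l (c i)))%:E * iid P n A)%E.
Proof.
move=> Pl; elim=> [|n IHn] c A mA.
  (* There is only one empty tuple, so the translation is the identity. *)
  rewrite big_ord0 expR0 mul1e /=.
  rewrite [X in \d_[tuple] X](_ : _ = A)//.
  by apply/funext => z /=; congr (A _); apply: eq_from_tnth => -[].
rewrite big_ord_recl expRD /= /pushforward.
pose f := fun x : R => x + c ord0.
pose g := fun z : n.-tuple R => [tuple tnth z i + c (lift ord0 i) | i < n].
rewrite [X in product_probability _ _ X](_ : _ =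
    (fun z => (f z.1, g z.2)) @^-1` (@consT R n @^-1` A)); last first.
  apply/funext => -[x z] /=; congr (A _).
  apply: eq_from_tnth => i; rewrite tnth_mktuple.
  by case: (unliftP ord0 i) => [k|] ->; rewrite /consT ?tnthS ?tnth0//= tnth_mktuple.
apply: product_probability_preimage_le; rewrite ?expR_ge0//.
- exact: measurable_funD.
- apply/measurable_fun_tnthP => i.
  rewrite (_ : _ \o _ = fun z : n.-tuple R => tnth z i + c (lift ord0 i)).
    by apply: measurable_funD => //; exact: measurable_tnth.
  by apply/funext => z /=; rewrite tnth_mktuple.
- by move=> B mB; exact: Pl.
- by move=> B mB; exact: IHn.
- rewrite -[X in measurable X]setTI.
  exact: (measurable_cons (f := fst) (g := snd)).
Qed.

(** * Sensitivities and the exponential mechanism *)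

Lemma sum_normr_freqB (R : realType) (N : nat) (dom : 'I_N -> finType) (n : nat)
    (D D' : dataset dom n) (S : {set 'I_N}) :
  Defs.adjacent D D' ->
  \sum_a `|(freq D S a)%:R - (freq D' S a)%:R| <= 2 :> R.
Proof.
move=> /card1P[l0 Hl0].
have out l : l != l0 -> tnth D l = tnth D' l.
  by move=> ll0; have := Hl0 l; rewrite !inE (negbTE ll0) => /negbFE/eqP.
have freqE (E : dataset dom n) a :
    (freq E S a)%:R = (value_on S (tnth E l0) == a)%:R +
      \sum_(l | l != l0) (value_on S (tnth E l) == a)%:R :> R.
  rewrite -(bigD1 l0 (P := xpredT) (F := fun l => (value_on S (tnth E l) == a)%:R))//.
  rewrite /freq -sum1_count big_mkcond/= big_tuple natr_sum.
  by apply: eq_bigr => l _; case: eqP.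
have indE (E : dataset dom n) : \sum_a (value_on S (tnth E l0) == a)%:R = 1 :> R.
  rewrite (bigD1 (value_on S (tnth E l0)))//= eqxx big1 ?addr0// => a.
  by rewrite eq_sym => /negbTE ->.
(* The records other than [l0] cancel, and record [l0] occupies exactly one cell in each dataset:
   the bound is 1 + 1. *)
rewrite [leRHS](_ : _ = \sum_a (value_on S (tnth D l0) == a)%:R +
    \sum_a (value_on S (tnth D' l0) == a)%:R); last by rewrite !indE.
rewrite -big_split/=.
apply: ler_sum => a _; rewrite !freqE (eq_bigr (fun l =>
  (value_on S (tnth D' l) == a)%:R)); last by move=> l /out ->.
by rewrite opprD addrACA subrr addr0 (le_trans (ler_normB _ _))// !normr_nat.
Qed.

Lemma mutual_info_adjacent_le (R : realType) (N : nat) (dom : 'I_N -> finType)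
    (n k : nat) (D D' : dataset dom n) (i : 'I_N) (Pa : {set 'I_N}) :
  Defs.adjacent D D' -> i \notin Pa -> (#|Pa| <= k)%N ->
  `|mutual_info R D i Pa - mutual_info R D' i Pa| <= mi_sensitivity dom R n k.
Proof.
move=> DD' iPa Pak; rewrite /mi_sensitivity.
apply: (Order.TotalTheory.bigmax_sup (D, D')) => //=.
by apply: (Order.TotalTheory.bigmax_sup (i, Pa)) => //=; rewrite iPa Pak.
Qed.

Lemma exp_mechanism_le (R : realType) (T : finType) (C : {set T})
    (eps sens : R) (f g : T -> R) (t : T) :
  0 <= eps -> (forall u, u \in C -> `|f u - g u| <= sens) ->
  exp_mechanism C eps sens f t <= expR eps * exp_mechanism C eps sens g t.
Proof.
move=> eps0 fg; rewrite /exp_mechanism; case: ifPn => [tC|_]; last first.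
  by rewrite mulr0.
have expo u (p q : T -> R) : u \in C -> `|p u - q u| <= sens ->
    eps * p u / (2 * sens) <= eps / 2 + eps * q u / (2 * sens).
  move=> uC pq; have sens0 : 0 <= sens by exact: le_trans pq.
  (* For zero sensitivity, division by zero makes both exponents 0, and [0 <= eps / 2] remains. *)
  have [s0|s0] := eqVneq sens 0.
    by rewrite s0 mulr0 invr0 !mulr0 addr0 divr_ge0.
  have {sens0}s0 : 0 < sens by rewrite lt0r s0.
  rewrite -lerBlDr -mulrBl -mulrBr ler_pdivrMr ?mulr_gt0//.
  rewrite mulrA divfK ?pnatr_eq0//; apply: ler_wpM2l => //.
  exact: le_trans (ler_norm _) pq.
pose Z (p : T -> R) := \sum_(u in C) expR (eps * p u / (2 * sens)).
have Z0 p : 0 < Z p.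
  rewrite /Z (bigD1 t)//= ltr_pwDl ?expR_gt0// sumr_ge0//.
(* To be used with [e = expR (eps / 2)]. The normalising sums are compared in the opposite direction
   to the weights, so [f] and [g] trade places there. *)
have ratio a b x y e : 0 < x -> 0 < y -> 0 <= a -> a <= e * b -> y <= e * x ->
    a / x <= e * e * (b / y) :> R.
  move=> x0 y0 a0 ab yx; rewrite ler_pdivrMr// mulrA [leRHS]mulrAC ler_pdivlMr//.
  by rewrite -[leRHS]mulrA mulrACA ler_pM// ltW.
rewrite [X in expR X * (_ / _)](splitr eps) expRD.
apply: ratio; rewrite ?expR_ge0 ?Z0//.
  by rewrite -expRD ler_expR; apply: expo => //; exact: fg.
rewrite /Z mulr_sumr; apply: ler_sum => u uC.
by rewrite -expRD ler_expR; apply: expo => //; rewrite distrC; exact: fg.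
Qed.

(** * Two inputs that differ only in the data of holder [j] *)

Section neighbours.
Variables (R : realType) (N M : nat) (dom : 'I_N -> finType) (nrec : 'I_M -> nat).
Variables (D D' : forall j : 'I_M, dataset dom (nrec j)) (j : 'I_M).
Hypothesis adjD : Defs.adjacent (D j) (D' j).
Hypothesis eqD : forall i, i != j -> D i = D' i.

Lemma prod_vote_prob_le (k : nat) (eps1 : R) (G : bn_structure N)
    (v : profile N M) : 0 <= eps1 ->
  \prod_i vote_prob k eps1 D G i (v i) <=
  expR (eps1 / N.-1%:R) * \prod_i vote_prob k eps1 D' G i (v i).
Proof.
move=> eps10; rewrite (bigD1 j)//= [in leRHS](bigD1 j)//= mulrA.
rewrite (eq_bigr (fun i => vote_prob k eps1 D' G i (v i))); last first.
  by move=> i ij; rewrite /vote_prob eqD.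
apply: ler_wpM2r; first by apply: prodr_ge0 => i _; exact: vote_prob_ge0.
apply: exp_mechanism_le; first by rewrite divr_ge0.
move=> [i Pa]; rewrite inE/= => /and3P[iG PaG Pak].
apply: mutual_info_adjacent_le => //.
(* The parents of a candidate are already placed and its attribute is not, so the pair is among
   those over which the sensitivity is maximised. *)
by apply: contra iG => /(fintype.subsetP PaG).
Qed.

Let count_index := ('I_N * 'I_M * passign dom)%type.

(** The sign is such that noise [z] on [D] and noise [z] plus this shift on [D'] yield the same
    noisy counts. *)
Definition count_shift (G : bn_structure N) (ija : count_index) : R :=
  let: (i, h, a) := ija in
  if passign_dom a == fam G i
  then (freq (D h) (fam G i) a)%:R - (freq (D' h) (fam G i) a)%:R else 0.

(** Data and noise enter the joint and conditional tables only through the noisy counts. The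
    equality therefore holds for every [z], even where a denominator vanishes. *)
Lemma release_translate (h : seq (profile N M)) (G : bn_structure N)
    (z : vec R count_index) :
  release D h G z =
  release D' h G [tuple tnth z t + count_shift G (enum_val t) | t < #|{: count_index}|].
Proof.
set z' := [tuple _ | _ < _].
have cE : noisy_count D G z = noisy_count D' G z'.
  apply/funext => -[[i l] a]; rewrite /noisy_count; case: ifPn => // aG.
  by rewrite /vcoord tnth_mktuple enum_rankK /count_shift aG addrCA subrKC addrC.
have jE : noisy_joint D G z = noisy_joint D' G z'.
  by apply/funext => ia; rewrite /noisy_joint cE.
have pE : noisy_cond D G z = noisy_cond D' G z'.
  by apply/funext => ia; rewrite /noisy_cond jE.
by rewrite /release cE jE pE.
Qed.

Lemma sum_normr_count_shift (G : bn_structure N) :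
  \sum_ija `|count_shift G ija| <= 2 * N%:R.
Proof.
rewrite (_ : \sum_ija _ = \sum_i \sum_l \sum_a `|count_shift G (i, l, a)|); last first.
  by rewrite pair_bigA pair_bigA; apply: eq_bigr => -[[]].
rewrite [leRHS](_ : _ = \sum_(i < N) 2); last first.
  by rewrite sumr_const card_ord mulr_natr.
(* For each attribute, only the counts of holder [j] move, by at most 2 in total. *)
apply: ler_sum => i _; rewrite (bigD1 j)//= [X in _ + X]big1 ?addr0; last first.
  move=> l lj; rewrite big1// => a _; rewrite eqD// subrr.
  by case: ifP; rewrite normr0.
apply: le_trans (sum_normr_freqB R (fam G i) adjD).
by apply: ler_sum => a _; case: ifPn; rewrite ?normr0.
Qed.

Lemma learn_parameters_le (eps2 : R) (h : seq (profile N M)) (G : bn_structure N)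
    (A : set (output R M dom)) :
  (0 < N)%N -> 0 < eps2 -> measurable A ->
  (learn_parameters eps2 D h G A <=
   (expR eps2)%:E * learn_parameters eps2 D' h G A)%E.
Proof.
move=> N0 eps20 mA; rewrite /learn_parameters.
have s0 : 0 < 2 * N%:R / eps2 by rewrite divr_gt0// mulr_gt0// ltr0n.
have mB : measurable (release D' h G @^-1` A).
  by rewrite -[X in measurable X]setTI; exact: measurable_release.
pose c t := count_shift G (@enum_val count_index xpredT t).
have -> : release D h G @^-1` A = (fun z : vec R count_index =>
    [tuple tnth z t + c t | t < _]) @^-1` (release D' h G @^-1` A).
  by apply/funext => z /=; rewrite release_translate.
have := @iid_translate _ (laplace_prob (2 * N%:R / eps2))
  (fun x => `|x| / (2 * N%:R / eps2))
  (fun x B mB => laplace_prob_translate x s0 mB) _ c _ mB.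
move=> /le_trans; apply; apply: lee_wpmul2r => //.
(* A total shift of at most [2 * N%:R], divided by the scale [2 * N%:R / eps2], is at most
   [eps2]. *)
rewrite lee_fin ler_expR -mulr_suml ler_pdivrMr// mulrC divfK ?gt_eqF//.
rewrite /c -(big_enum_val (A := xpredT) (fun ija => `|count_shift G ija|))/=.
exact: sum_normr_count_shift.
Qed.

(** Induction on the rounds left, for all [h] and [G]. Given the votes, [tiebreak] does not look at
    the data, so both runs continue from the same state and can be compared profile by profile. *)
Lemma run_le (k : nat) (eps1 eps2 : R)
    (tiebreak : seq (profile N M) -> profile N M -> vote N)
    (A : set (output R M dom)) :
  (0 < N)%N -> 0 <= eps1 -> 0 < eps2 -> measurable A ->
  forall r h G,
  (run k eps1 eps2 tiebreak D r h G A <=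
   (expR (eps1 / N.-1%:R *+ r + eps2))%:E * run k eps1 eps2 tiebreak D' r h G A)%E.
Proof.
move=> N0 eps10 eps20 mA; elim=> [|r IHr] h G /=.
  by rewrite mulr0n add0r; exact: learn_parameters_le.
rewrite ge0_sume_distrr; last first.
  move=> v _; rewrite mule_ge0 ?run_ge0// lee_fin prodr_ge0// => i _.
  exact: vote_prob_ge0.
apply: lee_sum => v _.
rewrite mulrS -addrA expRD EFinM muleACA -EFinM.
apply: lee_pmul; rewrite ?run_ge0//.
  by rewrite lee_fin prodr_ge0// => i _; exact: vote_prob_ge0.
by rewrite lee_fin; exact: prod_vote_prob_le.
Qed.

End neighbours.

Theorem theorem3p7 (R : realType) (N M : nat) (dom : 'I_N -> finType)
    (nrec : 'I_M -> nat) (k : nat) (eps1 eps2 : R)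
    (heps1 : 0 < eps1) (heps2 : 0 < eps2) (X0 : 'I_N)
    (tiebreak : seq (profile N M) -> profile N M -> vote N)
    (htiebreak : forall h v, most_voted v (tiebreak h v))
    (D : forall j : 'I_M, dataset dom (nrec j)) (j : 'I_M) :
  differentially_private (eps1 + eps2)
    (fun Dj : dataset dom (nrec j) =>
       overall k eps1 eps2 X0 tiebreak (dfwith D j Dj)
         : probability (output R M dom) R).
Proof.
(* This makes the Laplace scale positive, away from the Dirac default of [laplace_prob]. *)
have N0 : (0 < N)%N by exact: leq_ltn_trans (ltn_ord X0).
move=> E E' EE' A mA /=.
have adjE : Defs.adjacent (dfwith D j E j) (dfwith D j E' j) by rewrite !dfwithin.
have eqE i : i != j -> dfwith D j E i = dfwith D j E' i.
  by move=> ij; rewrite !dfwithout// eq_sym.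
apply: le_trans (run_le adjE eqE k tiebreak N0 (ltW heps1) heps2 mA _ _ _) _.
apply: lee_wpmul2r; first exact: run_ge0.
rewrite lee_fin ler_expR lerD2r -mulr_natr.
(* With a single attribute there is no round of voting, and [0 <= eps1] suffices; otherwise the
   [N.-1] rounds cost exactly [eps1]. *)
have [->|N1] := eqVneq N.-1 0%N; first by rewrite mulr0 ltW.
by rewrite divfK// pnatr_eq0.
Qed.
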